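(* Let $A$ be an algebra with differential calculus $(\mathrm{d},\Omega^*A)$. The cohomology $(E,\nabla)\mapsto H^*(A;E,\nabla)$ is a functor from ${}_A\mathcal{F}$ to graded left $H^*_{dR}(A)$-modules. Here a morphism $\phi:E\to F$ acts by the maps induced by $\mathrm{id}\otimes\phi:\Omega^nA\otimes_AE\to\Omega^nA\otimes_AF$, and the $H^*_{dR}(A)$-module structure is the one induced by $\xi\wedge(\omega\otimes e)=(\xi\wedge\omega)\otimes e$.
   Context: Algebras are unital over a field $k$. A differential calculus on $A$ is a differential graded algebra $(\mathrm{d},\Omega^*A)$ with $\Omega^0A=A$ and product $\wedge$; $H^*_{dR}(A)$ is its cohomology. A connection on a left $A$-module $E$ is a linear map $\nabla:E\to\Omega^1A\otimes_AE$ with $\nabla(a.e)=\mathrm{d}a\otimes e+a\nabla e$. Put $\nabla^{[n]}:\Omega^nA\otimes_AE\to\Omega^{n+1}A\otimes_AE$, $\nabla^{[n]}(\omega\otimes e)=\mathrm{d}\omega\otimes e+(-1)^n\omega\wedge\nabla e$. The connection is flat if its curvature $R=\nabla^{[1]}\nabla$ is zero. ${}_A\mathcal{F}$ is the category of left $A$-modules with flat connection; its morphisms $\phi:(E,\nabla)\to(F,\nabla)$ are the left $A$-module maps with $\nabla\circ\phi=(\mathrm{id}\otimes\phi)\circ\nabla$. For $(E,\nabla)\in{}_A\mathcal{F}$, $H^*(A;E,\nabla)$ is the cohomology of the complex $E\xrightarrow{\nabla}\Omega^1A\otimes_AE\xrightarrow{\nabla^{[1]}}\Omega^2A\otimes_AE\xrightarrow{\nabla^{[2]}}\cdots$.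 *)

(* Defs.v *)
From HB Require Import structures.
From mathcomp Require Import all_boot all_order all_algebra.
From mathcomp Require Import boolp.
From mathcomp.multinomials Require Import freeg.

Set Implicit Arguments.
Unset Strict Implicit.
Unset Printing Implicit Defensive.

Import GRing.Theory.
Local Open Scope ring_scope.
Local Open Scope quotient_scope.

Section Kernel.
Variables (R : pzRingType) (V W : lmodType R) (f : {linear V -> W}).

Definition kerb : {pred V} := fun v => f v == 0.

Fact kerb_closed : submod_closed kerb.
Proof.
split=> [|a u v /eqP Hu /eqP Hv]; apply/eqP; first exact: linear0.
by rewrite linearP Hu Hv scaler0 addr0.
Qed.
HB.instance Definition _ := GRing.isSubmodClosed.Build R V kerb kerb_closed.

Record kernel := Kernel { kernel_val :> V; kernelP : kernel_val \in kerb }.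
HB.instance Definition _ := [isSub for kernel_val].
HB.instance Definition _ := [Choice of kernel by <:].
HB.instance Definition _ := [SubChoice_isSubLmodule of kernel by <:].
End Kernel.

(* lquot G is the quotient of V by the submodule generated by the vectors
   satisfying G. *)
Section SpanQuotient.
Variables (R : pzRingType) (V : lmodType R) (G : V -> Prop).

Inductive lspan : V -> Prop :=
| lspan0 : lspan 0
| lspanS a g v : G g -> lspan v -> lspan (a *: g + v).

Definition lspanb : {pred V} := fun v => `[< lspan v >].

Fact lspanb_closed : submod_closed lspanb.
Proof.
split=> [|a u v /asboolP Hu /asboolP Hv]; apply/asboolP; first exact: lspan0.
elim: Hu => [|b g w Gg _ IH]; first by rewrite scaler0 add0r.
by rewrite scalerDr scalerA -addrA; apply: lspanS.
Qed.
HB.instance Definition _ := GRing.isSubmodClosed.Build R V lspanb lspanb_closed.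

Definition lquot := Quotient.quot lspanb.
HB.instance Definition _ := Choice.on lquot.
HB.instance Definition _ := GRing.Zmodule.on lquot.
HB.instance Definition _ := EqQuotient.on lquot.
Definition lproj (v : V) : lquot := \pi_lquot v.

Lemma lproj_eqP u v : (lproj u = lproj v) <-> lspan (u - v).
Proof.
have E : (u - v \in lspanb) = (lproj u == lproj v) by rewrite /lproj Quotient.idealrBE.
split=> [/eqP|/asboolP H]; first by rewrite -E => /asboolP.
by apply/eqP; rewrite -E.
Qed.

Definition lquot_scale (a : R) (x : lquot) : lquot := lproj (a *: repr x).

Lemma lprojD : {morph lproj : u v / u + v}.
Proof. by move=> u v; rewrite /lproj; rewrite !piE. Qed.

Lemma lproj_scale a v : lquot_scale a (lproj v) = lproj (a *: v).
Proof.
have H : repr (lproj v) - v \in lspanb.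
  by apply/asboolP/lproj_eqP; rewrite /lproj reprK.
apply/lproj_eqP; rewrite -scalerBr; apply/asboolP.
rewrite -[`[< _ >]]/(_ \in lspanb). exact: rpredZ.
Qed.

Lemma lprojW (P : lquot -> Prop) : (forall v, P (lproj v)) -> forall x, P x.
Proof. by move=> H x; rewrite -[x]reprK; apply: H. Qed.

Fact lquot_scaleA a b x : lquot_scale a (lquot_scale b x) = lquot_scale (a * b) x.
Proof. by elim/lprojW: x => v; rewrite !lproj_scale scalerA. Qed.
Fact lquot_scale1 : left_id 1 lquot_scale.
Proof. by elim/lprojW=> v; rewrite lproj_scale scale1r. Qed.
Fact lquot_scaleDr : right_distributive lquot_scale +%R.
Proof.
move=> a; elim/lprojW=> u; elim/lprojW=> v.
by rewrite -lprojD !lproj_scale scalerDr lprojD.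
Qed.
Fact lquot_scaleDl x : {morph lquot_scale^~ x : a b / a + b}.
Proof. by elim/lprojW: x => v a b; rewrite !lproj_scale scalerDl lprojD. Qed.
HB.instance Definition _ := GRing.Zmodule_isLmodule.Build R lquot
  lquot_scaleA lquot_scale1 lquot_scaleDr lquot_scaleDl.

Fact lproj_linear : linear lproj.
Proof. by move=> a u v; rewrite lprojD -lproj_scale. Qed.
HB.instance Definition _ := GRing.isLinear.Build R V lquot *:%R lproj lproj_linear.

Definition lquot_lift (T : Type) (f : V -> T) (x : lquot) : T := f (repr x).

Section LiftLinear.
Variables (W : lmodType R) (f : {linear V -> W}).
Hypothesis f0 : forall g, G g -> f g = 0.

Lemma lquot_liftE v : lquot_lift f (lproj v) = f v.
Proof.
have: lspan (repr (lproj v) - v) by apply/lproj_eqP; rewrite /lproj reprK.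
rewrite /lquot_lift => H; apply/eqP; rewrite -subr_eq0 -linearB; apply/eqP.
by elim: H => [|a g w /f0 fg _ IH]; rewrite ?linear0 // linearP fg scaler0 add0r.
Qed.

Lemma lquot_lift_linear : linear (lquot_lift f : lquot -> W).
Proof.
by move=> a; elim/lprojW=> u; elim/lprojW=> v; rewrite -linearP !lquot_liftE linearP.
Qed.
End LiftLinear.
End SpanQuotient.
Arguments lproj {R V} G v.
Arguments lquot_lift {R V G T} f x.


Section LinearFacts.
Variables (R : pzRingType) (V W : lmodType R) (f : V -> W).
Hypothesis f_lin : linear f.

Lemma lin0 : f 0 = 0.
Proof. by have := f_lin (-1) 0 0; rewrite scaler0 addr0 scaleN1r addNr. Qed.
Lemma linZ a u : f (a *: u) = a *: f u.
Proof. by have := f_lin a u 0; rewrite !addr0 lin0 addr0. Qed.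
Lemma linD u v : f (u + v) = f u + f v.
Proof. by have := f_lin 1 u v; rewrite !scale1r. Qed.
Lemma linN u : f (- u) = - f u.
Proof. by rewrite -scaleN1r linZ scaleN1r. Qed.
Lemma linB u v : f (u - v) = f u - f v.
Proof. by rewrite linD linN. Qed.
End LinearFacts.

Section FreeLift.
Variables (R : nzRingType) (K : choiceType) (M : lmodType R) (f : K -> M).

Fact fglift_linear : linear (fglift f).
Proof.
have fgB : {morph fglift f : x y / x - y} by exact: lift_is_additive.
pose F := GRing.isZmodMorphism.Build _ _ (fglift f) fgB.
pose fl : {additive {freeg K / R} -> M} := HB.pack (fglift f) F.
have fsum I (r : seq I) (g : I -> {freeg K / R}) :
    fglift f (\sum_(i <- r) g i) = \sum_(i <- r) fglift f (g i).
  exact: (raddf_sum fl).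
move=> a u v; rewrite [LHS](raddfD fl) /=; congr (_ + _).
rewrite -[in RHS](freeg_sumE u) -[a *: u]/(\sum_(x <- dom u) << a * coeff x u *g x >>).
rewrite !fsum scaler_sumr.
by apply: eq_bigr => x _ /=; rewrite !liftU scalerA.
Qed.
HB.instance Definition _ :=
  GRing.isLinear.Build R {freeg K / R} M *:%R (fglift f) fglift_linear.
End FreeLift.

(* The tensor product over A of a right module M (a k-vector space with right
   action ract) and a left module E: the free k-vector space on M * E modulo
   the usual relations. *)
Section Tensor.
Variables (k : fieldType) (A : algType k) (M : lmodType k) (ract : M -> A -> M).
Variable E : lmodType A.
Local Notation free := {freeg (M * E)%type / k}.

Inductive tensor_rel : free -> Prop :=
| rel_addl m m' e : tensor_rel (<< (m + m', e) >> - << (m, e) >> - << (m', e) >>)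
| rel_scale c m e : tensor_rel (<< (c *: m, e) >> - c *: << (m, e) >>)
| rel_addr m e e' : tensor_rel (<< (m, e + e') >> - << (m, e) >> - << (m, e') >>)
| rel_act m a e : tensor_rel (<< (ract m a, e) >> - << (m, a *: e) >>).

Definition tensor : lmodType k := lquot tensor_rel.
Definition tensor_pure (m : M) (e : E) : tensor := lproj tensor_rel << (m, e) >>.
Definition tensor_lift (V : lmodType k) (f : M -> E -> V) (t : tensor) : V :=
  lquot_lift (fglift (fun me => f me.1 me.2)) t.

Record balanced (V : lmodType k) (f : M -> E -> V) : Prop := Balanced {
  bal_linear : forall e, linear (f^~ e);
  bal_addr : forall m, {morph f m : e e' / e + e'};
  bal_act : forall m a e, f (ract m a) e = f m (a *: e) }.

Section Lift.
Variables (V : lmodType k) (f : M -> E -> V).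
Hypothesis bf : balanced f.

Fact tensor_rel_lift g : tensor_rel g -> fglift (fun me => f me.1 me.2) g = 0.
Proof.
have L e := bal_linear bf e.
case=> [m m' e|c m e|m e e'|m a e].
- by rewrite !linearB /= !liftU !scale1r /= (linD (L e)) -addrA -opprD subrr.
- by rewrite linearB linearZ /= !liftU !scale1r /= (linZ (L e)) subrr.
- by rewrite !linearB /= !liftU !scale1r /= (bal_addr bf) -addrA -opprD subrr.
- by rewrite linearB /= !liftU !scale1r /= (bal_act bf) subrr.
Qed.

Lemma tensor_liftE m e : tensor_lift f (tensor_pure m e) = f m e.
Proof.
by rewrite /tensor_lift (lquot_liftE tensor_rel_lift) /= liftU scale1r.
Qed.

Lemma tensor_lift_linear : linear (tensor_lift f).
Proof. exact: lquot_lift_linear tensor_rel_lift. Qed.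
End Lift.

Lemma tensor_pure_balanced : balanced tensor_pure.
Proof.
have P r : tensor_rel r -> lproj tensor_rel r = 0.
  move=> H; rewrite -(linear0 (lproj tensor_rel)); apply/lproj_eqP.
  rewrite -[r]scale1r subr0 -[_ *: r]addr0.
  by apply: lspanS; rewrite ?scale1r //; apply: lspan0.
have PB u v : tensor_rel (u - v) -> lproj tensor_rel u = lproj tensor_rel v.
  by move=> /P /eqP; rewrite linearB subr_eq0 => /eqP.
split=> [e|m e e'|m a e].
- have hD m m' : tensor_pure (m + m') e = tensor_pure m e + tensor_pure m' e.
    rewrite /tensor_pure -linearD; apply: PB.
    by rewrite opprD addrA; apply: rel_addl.
  move=> c m m'; rewrite hD; congr (_ + _).
  by rewrite /tensor_pure -linearZ; apply: PB; apply: rel_scale.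
- rewrite /tensor_pure -linearD; apply: PB.
  by rewrite opprD addrA; apply: rel_addr.
- by apply: PB; apply: rel_act.
Qed.

Lemma tensor_ext (V : lmodType k) (f g : tensor -> V) :
  linear f -> linear g ->
  (forall m e, f (tensor_pure m e) = g (tensor_pure m e)) -> f =1 g.
Proof.
move=> Lf Lg fg; elim/lprojW => v; rewrite -(freeg_sumE v) linear_sum /=.
elim: (dom v) => [|x s IH]; first by rewrite big_nil (lin0 Lf) (lin0 Lg).
rewrite big_cons (linD Lf) (linD Lg) IH; congr (_ + _).
have -> : << coeff x v *g x >> = coeff x v *: << (x.1, x.2) >> :> free.
  by apply/eqP/freeg_eqP=> z; rewrite coeff_fgscale !coeffU mul1r -surjective_pairing.
by rewrite linearZ (linZ Lf) (linZ Lg) fg.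
Qed.
End Tensor.

(* gcast moves a homogeneous element along an equality of degrees; it occurs
   below where two degrees are equal but not convertible.  Note that 0 + n is
   convertible to n, and m.+1 + n to (m + n).+1. *)
Section Cast.
Variables (k : pzRingType) (V : nat -> lmodType k).

Definition gcast m n (e : m = n) (x : V m) : V n := ecast i (V i) e x.

Lemma gcast_id n (e : n = n) x : gcast e x = x.
Proof. by rewrite (eq_irrelevance e erefl). Qed.
Lemma gcast_irr m n (e e' : m = n) x : gcast e x = gcast e' x.
Proof. by rewrite (eq_irrelevance e e'). Qed.
Lemma gcast_trans m n p (e : m = n) (e' : n = p) x :
  gcast e' (gcast e x) = gcast (etrans e e') x.
Proof. by case: p / e'; rewrite gcast_id; apply: gcast_irr. Qed.
Lemma gcast_linear m n (e : m = n) : linear (gcast e).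
Proof. by case: n / e => a u v; rewrite !gcast_id. Qed.
HB.instance Definition _ m n (e : m = n) :=
  GRing.isLinear.Build k (V m) (V n) *:%R (gcast e) (@gcast_linear m n e).
End Cast.

Lemma gcast_nat (k : pzRingType) (V W : nat -> lmodType k) (s : nat -> nat)
    (f : forall n, V n -> W (s n)) m n (e : m = n) x :
  f n (gcast e x) = gcast (congr1 s e) (f m x).
Proof. by case: n / e; rewrite !gcast_id. Qed.

Record graded_algebra (k : fieldType) (V : nat -> lmodType k) := GradedAlgebra {
  gone : V 0;
  gmul : forall m n, V m -> V n -> V (m + n)%N;
  gmul_linear_l : forall m n (y : V n), linear (fun x : V m => gmul x y);
  gmul_linear_r : forall m n (x : V m), linear (fun y : V n => gmul x y);
  gmulA : forall m n p (x : V m) (y : V n) (z : V p),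
    gcast (addnA m n p) (gmul x (gmul y z)) = gmul (gmul x y) z;
  gmul1l : forall n (x : V n), gmul gone x = x;
  gmul1r : forall n (x : V n), gcast (addn0 n) (gmul x gone) = x }.

(* The family A, P 0, P 1, ...: the degree 0 part is A itself. *)
Definition forms (k : fieldType) (A : algType k) (P : nat -> lmodType k)
    (n : nat) : lmodType k :=
  if n is m.+1 then P m else A.

Record calculus (k : fieldType) (A : algType k) := Calculus {
  pos_forms : nat -> lmodType k;
  Omega : nat -> lmodType k := forms A pos_forms;
  wedge : graded_algebra Omega;
  wedge_one : gone wedge = (1 : A);
  wedge_mul : forall a b : A, gmul wedge (m := 0) (n := 0) a b = a * b :> A;
  dif : forall n, {linear Omega n -> Omega n.+1};
  dif_wedge : forall m n (x : Omega m) (y : Omega n),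
    dif (m + n) (gmul wedge x y) =
      gmul wedge (dif m x) y
      + (-1) ^+ m *: gcast (addnS m n) (gmul wedge x (dif n y));
  dif_dif : forall n (x : Omega n), dif n.+1 (dif n x) = 0 }.

Record complex (k : fieldType) := Complex {
  cochain :> nat -> lmodType k;
  cdiff : forall n, {linear cochain n -> cochain n.+1};
  cdiff_cdiff : forall n (x : cochain n), cdiff n.+1 (cdiff n x) = 0 }.

Section Cohomology.
Variables (k : fieldType) (C : complex k).

Definition cocycle n := kernel (cdiff C n).
Definition coboundary n : C n -> Prop :=
  match n with
  | 0 => fun x => x = 0
  | m.+1 => fun x => exists y : C m, cdiff C m y = x
  end.
(* Every coboundary is a cocycle (cdiff_cdiff), so this is the quotient of the
   space of cocycles by the space of coboundaries (see cohomology_eqP). *)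
Definition cohomology n : lmodType k :=
  lquot (fun z : cocycle n => coboundary (kernel_val z)).
(* x is a cocycle, and its cohomology class is h. *)
Definition represents n (x : C n) (h : cohomology n) : Prop :=
  exists2 z : cocycle n, kernel_val z = x & lproj _ z = h.

(* The class of x if x is a cocycle, and 0 otherwise. *)
Definition coh_class n (x : C n) : cohomology n := lproj _ (insubd 0 x : cocycle n).

Lemma coboundary_linear n a (x y : C n) :
  coboundary x -> coboundary y -> coboundary (a *: x + y).
Proof.
case: n x y => [|n] x y /=; first by move=> -> ->; rewrite scaler0 addr0.
by move=> [u <-] [v <-]; exists (a *: u + v); rewrite linearP.
Qed.

Lemma coboundary0 n : coboundary (0 : C n).
Proof. by case: n => [|n] //=; exists 0; rewrite linear0. Qed.

Lemma cohomology_eqP n (z z' : cocycle n) :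
  lproj (fun z : cocycle n => coboundary (kernel_val z)) z = lproj _ z' <->
  coboundary (kernel_val z - kernel_val z').
Proof.
split=> [/lproj_eqP|H].
  rewrite -[kernel_val z - _]/(kernel_val (z - z')).
  by elim=> [|a g v Gg _]; [exact: coboundary0 | exact: coboundary_linear].
apply/lproj_eqP; rewrite -[z - z']scale1r -[_ *: _]addr0.
by apply: lspanS; last exact: lspan0.
Qed.

Lemma coh_class_represents n (x : C n) : cdiff C n x = 0 -> represents x (coh_class x).
Proof.
move=> dx; exists (insubd 0 x) => //.
by apply: (insubdK (0 : cocycle n)); apply/eqP.
Qed.

Lemma represents_cdiff n (x : C n) h : represents x h -> cdiff C n x = 0.
Proof. by case=> z <- _; apply/eqP/(kernelP z). Qed.

Lemma represents_ex n (h : cohomology n) : exists x, represents x h.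
Proof. by elim/lprojW: h => z; exists (kernel_val z); exists z. Qed.

Lemma represents_repr n (h : cohomology n) : represents (kernel_val (repr h)) h.
Proof. by exists (repr h) => //; rewrite /lproj reprK. Qed.

Lemma represents_eqP n (x y : C n) h g :
  represents x h -> represents y g -> (h = g <-> coboundary (x - y)).
Proof. by case=> z <- <- [z' <- <-]; apply: cohomology_eqP. Qed.

Lemma represents_linear n a (x y : C n) h g :
  represents x h -> represents y g -> represents (a *: x + y) (a *: h + g).
Proof. by case=> z <- <- [z' <- <-]; exists (a *: z + z'); rewrite ?linearP. Qed.

Lemma represents_inj n (x : C n) h g : represents x h -> represents x g -> h = g.
Proof.
by move=> Hx Gx; apply/(represents_eqP Hx Gx); rewrite subrr; apply: coboundary0.
Qed.

Lemma coboundary_cast m n (e : m = n) (x : C m) :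
  coboundary (gcast e x) <-> coboundary x.
Proof. by case: n / e; rewrite gcast_id. Qed.

Lemma represents_cast m n (e : m = n) (x : C m) h :
  represents x h -> represents (gcast e x) (gcast (V := cohomology) e h).
Proof. by case: n / e; rewrite !gcast_id. Qed.
End Cohomology.

Section Pairing.
Variables (k : fieldType) (C D F : complex k).
Variable p : forall m n, C m -> D n -> F (m + n)%N.
Hypothesis p_linear_l : forall m n (y : D n), linear (fun x : C m => p x y).
Hypothesis p_linear_r : forall m n (x : C m), linear (fun y : D n => p x y).
Hypothesis p_cdiff : forall m n (x : C m) (y : D n),
  cdiff F (m + n) (p x y) = p (cdiff C m x) y
    + (-1) ^+ m *: gcast (addnS m n) (p x (cdiff D n y)).

Definition cohomology_pairing m n (h : cohomology C m) (g : cohomology D n) :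
    cohomology F (m + n) :=
  coh_class (p (kernel_val (repr h)) (kernel_val (repr g))).

Lemma pairing_cocycle m n (x : C m) (y : D n) :
  cdiff C m x = 0 -> cdiff D n y = 0 -> cdiff F (m + n) (p x y) = 0.
Proof.
move=> dx dy; rewrite p_cdiff dx dy (lin0 (p_linear_l _)) (lin0 (p_linear_r _)).
by rewrite linear0 scaler0 addr0.
Qed.

Lemma pairing_coboundary_l m n (x : C m) (y : D n) :
  coboundary x -> cdiff D n y = 0 -> coboundary (p x y).
Proof.
case: m x => [|m] x /=.
  by move=> -> _; rewrite (lin0 (p_linear_l _)); apply: coboundary0.
case=> b <- dy; exists (p b y).
by rewrite p_cdiff dy (lin0 (p_linear_r _)) linear0 scaler0 addr0.
Qed.

Lemma pairing_coboundary_r m n (x : C m) (y : D n) :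
  cdiff C m x = 0 -> coboundary y -> coboundary (p x y).
Proof.
case: n y => [|n] y dx /=.
  by move=> ->; rewrite (lin0 (p_linear_r _)); apply: coboundary0.
case=> b <-; apply/(coboundary_cast (addnS m n)); exists ((-1) ^+ m *: p x b).
rewrite linearZ /= p_cdiff dx (lin0 (p_linear_l _)) add0r scalerA -exprMn mulrNN mulr1.
by rewrite expr1n scale1r.
Qed.

Lemma cohomology_pairingP m n (x : C m) (y : D n) h g :
  represents x h -> represents y g ->
  represents (p x y) (cohomology_pairing h g).
Proof.
move=> Hx Gy; have Hh := represents_repr h; have Gg := represents_repr g.
have dx := represents_cdiff Hx; have dy := represents_cdiff Gy.
have H1 := coh_class_represents (pairing_cocycle dx dy).
have H2 := coh_class_represents
  (pairing_cocycle (represents_cdiff Hh) (represents_cdiff Gg)).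
suff E : coh_class (p x y) = cohomology_pairing h g by rewrite -E.
apply/(represents_eqP H1 H2).
set x' := kernel_val _ in H2 Hh *; set y' := kernel_val _ in H2 Gg *.
have -> : p x y - p x' y' = 1 *: p (x - x') y + p x' (y - y').
  by rewrite scale1r (linB (p_linear_l y)) (linB (p_linear_r x')) addrA subrK.
apply: coboundary_linear.
  by apply: pairing_coboundary_l => //; apply/(represents_eqP Hx Hh).
apply: pairing_coboundary_r; first exact: represents_cdiff Hh.
exact/(represents_eqP Gy Gg).
Qed.
End Pairing.

Section DeRham.
Variables (k : fieldType) (A : algType k) (Om : calculus A).

Definition deRham : complex k := @Complex k (Omega Om) (dif Om) (dif_dif (c := Om)).
Local Notation H := (cohomology deRham).
Local Notation W := (wedge Om).

Definition deRham_mul m n (h : H m) (g : H n) : H (m + n) :=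
  cohomology_pairing (C := deRham) (D := deRham) (F := deRham) (@gmul _ _ W) h g.
Definition deRham_one : H 0 := coh_class (C := deRham) (n := 0) (1 : A).

Lemma deRham_mulP m n (x : deRham m) (y : deRham n) h g :
  represents x h -> represents y g ->
  represents (C := deRham) (gmul W x y) (deRham_mul h g).
Proof.
apply: cohomology_pairingP; [exact: gmul_linear_l | exact: gmul_linear_r |].
exact: dif_wedge.
Qed.

Lemma dif_one : dif Om 0 (1 : A) = 0.
Proof.
pose e : Omega Om 0 := (1 : A); pose de : Omega Om 1 := dif Om 0 e.
have ee : gmul W e e = e by rewrite /e wedge_mul mulr1.
have We : gone W = e by exact: wedge_one.
have : de = gmul W de e + (-1) ^+ 0 *: gcast (addnS 0 0) (gmul W e de).
  by rewrite -(dif_wedge (c := Om) e e); exact/esym/(congr1 (dif Om 0) ee).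
have /= := gmul1r W de; rewrite gcast_id We => ->.
rewrite expr0 scale1r gcast_id -We gmul1l.
by move/eqP; rewrite -subr_eq subrr eq_sym => /eqP.
Qed.

Lemma deRham_oneP : represents (C := deRham) (n := 0) (1 : A) deRham_one.
Proof. exact/coh_class_represents/dif_one. Qed.

Fact deRham_mul_linear_l m n (g : H n) : linear (fun h : H m => deRham_mul h g).
Proof.
move=> a h h'.
have [x Hx] := represents_ex h; have [x' Hx'] := represents_ex h'.
have [y Gy] := represents_ex g.
have L := deRham_mulP (represents_linear a Hx Hx') Gy.
have R := represents_linear a (deRham_mulP Hx Gy) (deRham_mulP Hx' Gy).
by rewrite (gmul_linear_l W y) in L; apply: represents_inj L R.
Qed.

Fact deRham_mul_linear_r m n (h : H m) : linear (fun g : H n => deRham_mul h g).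
Proof.
move=> a g g'.
have [y Gy] := represents_ex g; have [y' Gy'] := represents_ex g'.
have [x Hx] := represents_ex h.
have L := deRham_mulP Hx (represents_linear a Gy Gy').
have R := represents_linear a (deRham_mulP Hx Gy) (deRham_mulP Hx Gy').
by rewrite (gmul_linear_r W x) in L; apply: represents_inj L R.
Qed.

Fact deRham_mulA m n q (h : H m) (g : H n) (f : H q) :
  gcast (V := H) (addnA m n q) (deRham_mul h (deRham_mul g f)) =
  deRham_mul (deRham_mul h g) f.
Proof.
have [x Hx] := represents_ex h; have [y Gy] := represents_ex g.
have [z Fz] := represents_ex f.
have L := represents_cast (addnA m n q) (deRham_mulP Hx (deRham_mulP Gy Fz)).
have R := deRham_mulP (deRham_mulP Hx Gy) Fz.
by rewrite (gmulA W) in L; apply: represents_inj L R.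
Qed.

Fact deRham_mul1l n (h : H n) : deRham_mul deRham_one h = h.
Proof.
have [x Hx] := represents_ex h; have := deRham_mulP deRham_oneP Hx.
by rewrite -(wedge_one Om) gmul1l => L; apply: represents_inj L Hx.
Qed.

Fact deRham_mul1r n (h : H n) : gcast (V := H) (addn0 n) (deRham_mul h deRham_one) = h.
Proof.
have [x Hx] := represents_ex h.
have := represents_cast (addn0 n) (deRham_mulP Hx deRham_oneP).
by rewrite -(wedge_one Om) gmul1r => L; apply: represents_inj L Hx.
Qed.

Definition deRham_algebra : graded_algebra H := GradedAlgebra
  deRham_mul_linear_l deRham_mul_linear_r deRham_mulA deRham_mul1l deRham_mul1r.
End DeRham.

(* A left A-module regarded as a k-vector space. *)
Section Restriction.
Variables (k : fieldType) (A : algType k) (E : lmodType A).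

Definition restr : Type := E.
HB.instance Definition _ := Choice.on restr.
HB.instance Definition _ := GRing.Zmodule.on restr.
Definition restr_scale (c : k) (e : restr) : restr := c%:A *: (e : E).

Fact restr_scaleA a b e : restr_scale a (restr_scale b e) = restr_scale (a * b) e.
Proof. by rewrite /restr_scale scalerA -scalerAl mul1r scalerA. Qed.
Fact restr_scale1 : left_id 1 restr_scale.
Proof. by move=> e; rewrite /restr_scale !scale1r. Qed.
Fact restr_scaleDr : right_distributive restr_scale +%R.
Proof. by move=> a e e'; rewrite /restr_scale scalerDr. Qed.
Fact restr_scaleDl e : {morph restr_scale^~ e : a b / a + b}.
Proof. by move=> a b; rewrite /restr_scale !scalerDl. Qed.
HB.instance Definition _ := GRing.Zmodule_isLmodule.Build k restr
  restr_scaleA restr_scale1 restr_scaleDr restr_scaleDl.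
End Restriction.

Section FormsTensor.
Variables (k : fieldType) (A : algType k) (Om : calculus A) (E : lmodType A).
Local Notation W := (wedge Om).

Definition form_act n (w : Omega Om n) (a : A) : Omega Om n :=
  gcast (addn0 n) (gmul W (n := 0) w a).

(* tens n is the tensor product of Omega^n and E over A.  Since Omega^0 = A, it
   is taken to be E itself in degree 0, with pure tensors a (x) e = a e; the
   complex of a flat connection thus starts with E, as it should. *)
Definition tens (n : nat) : lmodType k :=
  if n is m.+1 then tensor (@form_act m.+1) E else restr E.

Definition pure n : Omega Om n -> E -> tens n :=
  match n with
  | 0 => fun (a : A) e => a *: e
  | m.+1 => fun w e => tensor_pure (@form_act m.+1) w e
  end.

(* The linear map induced by a balanced map f. *)
Definition tens_lift (V : lmodType k) n : (Omega Om n -> E -> V) -> tens n -> V :=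
  match n with
  | 0 => fun f e => f (1 : A) e
  | m.+1 => fun f t => tensor_lift f t
  end.

Lemma form_act0 (a b : A) : form_act (n := 0) a b = a * b :> A.
Proof. by rewrite /form_act gcast_id wedge_mul. Qed.

Lemma pure_balanced n : balanced (@form_act n) (@pure n).
Proof.
case: n => [|n]; last exact: tensor_pure_balanced.
split=> [e c a b|a e e'|a b e] /=.
- by rewrite scalerDl -[c *: a]mulr_algl -scalerA.
- by rewrite scalerDr.
- by rewrite form_act0 scalerA.
Qed.

Lemma tens_liftE (V : lmodType k) n (f : Omega Om n -> E -> V) w e :
  balanced (@form_act n) f -> tens_lift f (pure w e) = f w e.
Proof.
case: n f w => [|n] f w bf; last exact: tensor_liftE.
by rewrite /= -(bal_act bf) form_act0 mul1r.
Qed.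

Lemma tens_lift_linear (V : lmodType k) n (f : Omega Om n -> E -> V) :
  balanced (@form_act n) f -> linear (tens_lift f).
Proof.
case: n f => [|n] f bf; last exact: tensor_lift_linear.
move=> c e e' /=; rewrite (bal_addr bf); congr (_ + _).
rewrite -[c *: e]/((c%:A : A) *: (e : E)) -(bal_act bf) form_act0 mul1r.
exact: (linZ (bal_linear bf e)).
Qed.

Lemma tens_ext (V : lmodType k) n (f g : tens n -> V) :
  linear f -> linear g ->
  (forall w e, f (pure w e) = g (pure w e)) -> f =1 g.
Proof.
case: n f g => [|n] f g Lf Lg fg; last exact: tensor_ext.
by move=> e; have := fg (1 : A) e; rewrite /= scale1r.
Qed.

Lemma pure_cast m n (e : m = n) (w : Omega Om m) x :
  pure (gcast e w) x = gcast (V := tens) e (pure w x).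
Proof. by case: n / e; rewrite !gcast_id. Qed.

Lemma gmul_castr m n n' (e : n = n') (x : Omega Om m) (y : Omega Om n) :
  gmul W x (gcast e y) = gcast (congr1 (addn m) e) (gmul W x y).
Proof. by case: n' / e; rewrite !gcast_id. Qed.

Lemma gmul_castl m m' n (e : m = m') (x : Omega Om m) (y : Omega Om n) :
  gmul W (gcast e x) y = gcast (congr1 (addn^~ n) e) (gmul W x y).
Proof. by case: m' / e; rewrite !gcast_id. Qed.

Lemma form_act_gmul m n (x : Omega Om m) (w : Omega Om n) a :
  gmul W x (form_act w a) = form_act (gmul W x w) a.
Proof.
rewrite /form_act gmul_castr -(gmulA W (p := 0)) gcast_trans.
exact: gcast_irr.
Qed.

Lemma lwedge_balanced m n (x : Omega Om m) :
  balanced (@form_act n) (fun w e => pure (gmul W x w) e).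
Proof.
split=> [e c w w'|w e e'|w a e].
- by rewrite (gmul_linear_r W x) (bal_linear (@pure_balanced _)).
- exact: (bal_addr (@pure_balanced _)).
- by rewrite form_act_gmul (bal_act (@pure_balanced _)).
Qed.

(* xi /\ (w (x) e) = (xi /\ w) (x) e; for xi in Omega^0 = A this is the left
   A-module structure of the tensor product. *)
Definition lwedge m n (x : Omega Om m) : tens n -> tens (m + n) :=
  tens_lift (fun w e => pure (gmul W x w) e).

Lemma lwedgeE m n (x : Omega Om m) (w : Omega Om n) e :
  lwedge x (pure w e) = pure (gmul W x w) e.
Proof. by rewrite /lwedge tens_liftE //; apply: lwedge_balanced. Qed.

Lemma lwedge_linear_r m n (x : Omega Om m) : linear (@lwedge m n x).
Proof. by apply: tens_lift_linear; apply: lwedge_balanced. Qed.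

Lemma lwedge_linear_l m n (t : tens n) : linear (fun x : Omega Om m => lwedge x t).
Proof.
move=> c x y; move: t; apply: tens_ext => [|a t t'|w e].
- exact: lwedge_linear_r.
- rewrite !(lwedge_linear_r _ a) !scalerDr !scalerA [c * a]mulrC.
  by rewrite -!addrA; congr (_ + _); rewrite addrCA.
- by rewrite !lwedgeE (gmul_linear_l W w) (bal_linear (@pure_balanced _)).
Qed.

Lemma lwedge_cast m n n' (e : n = n') (x : Omega Om m) (t : tens n) :
  lwedge x (gcast e t) = gcast (V := tens) (congr1 (addn m) e) (lwedge x t).
Proof. by case: n' / e; rewrite !gcast_id. Qed.

Lemma lwedgeA m n q (x : Omega Om m) (y : Omega Om n) (t : tens q) :
  gcast (V := tens) (addnA m n q) (lwedge x (lwedge y t)) = lwedge (gmul W x y) t.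
Proof.
move: t; apply: tens_ext => [a t t'|a t t'|w e].
- by rewrite !(lwedge_linear_r _ a) linearP.
- by rewrite !(lwedge_linear_r _ a).
- by rewrite !lwedgeE -pure_cast gmulA.
Qed.

Lemma lwedge1 n (t : tens n) : lwedge (m := 0) (1 : A) t = t.
Proof.
move: t; apply: tens_ext => [|//|w e]; first exact: lwedge_linear_r.
by rewrite lwedgeE -(wedge_one Om) gmul1l.
Qed.

Lemma gmul_act m n (w : Omega Om m) (a : A) (v : Omega Om n) :
  gmul W (form_act w a) v = gmul W w (gmul W (m := 0) (n := n) a v).
Proof.
rewrite /form_act gmul_castl -(gmulA W (n := 0)) gcast_trans.
exact: gcast_id.
Qed.

Lemma lwedge_act m n (w : Omega Om m) (a : A) (t : tens n) :
  lwedge (form_act w a) t = lwedge w (lwedge (m := 0) (n := n) a t : tens n).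
Proof.
move: t; apply: tens_ext => [|c t t'|v e]; first exact: lwedge_linear_r.
  by rewrite (lwedge_linear_r (m := 0) (n := n)) lwedge_linear_r.
by rewrite (lwedgeE (m := 0) (n := n)) !lwedgeE gmul_act.
Qed.

Lemma dif_act n (w : Omega Om n) (a : A) :
  dif Om n (form_act w a) = form_act (dif Om n w) a
    + (-1) ^+ n *: gcast (addn1 n) (gmul W w (dif Om 0 a)).
Proof.
rewrite /form_act (gcast_nat (V := Omega Om) (W := Omega Om) (s := S) (dif Om)).
rewrite dif_wedge linearD linearZ /= gcast_trans.
congr (_ + _ *: _).
  exact: (@gcast_irr _ (Omega Om) (n.+1 + 0) n.+1).
exact: (@gcast_irr _ (Omega Om) (n + 1) n.+1).
Qed.

Record connection := Connection {
  nabla :> restr E -> tens 1;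
  nabla_linear : linear nabla;
  nabla_leibniz : forall (a : A) (e : E),
    nabla (a *: e) = pure (dif Om 0 a) e + lwedge (m := 0) (n := 1) a (nabla e) }.

Section Connection.
Variable D : connection.

Definition nabla_ext n : tens n -> tens n.+1 :=
  tens_lift (fun (w : Omega Om n) (e : E) =>
    pure (dif Om n w) e
    + (-1) ^+ n *: gcast (V := tens) (addn1 n) (lwedge w (D e))).

Lemma nabla_ext_balanced n : balanced (@form_act n) (fun w e =>
    pure (dif Om n w) e
    + (-1) ^+ n *: gcast (V := tens) (addn1 n) (lwedge w (D e))).
Proof.
split=> [e c w w'|w e e'|w a e].
- rewrite linearP (bal_linear (@pure_balanced _)) (lwedge_linear_l (D e)) linearP.
  rewrite !scalerDr !scalerA [c * _]mulrC -!addrA; congr (_ + _).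
  by rewrite addrCA.
- rewrite (bal_addr (@pure_balanced _)) -[e + e']/(e + e' : restr E).
  rewrite (linD (nabla_linear D)) (linD (lwedge_linear_r w)) linearD scalerDr.
  by rewrite -!addrA; congr (_ + _); rewrite addrCA.
- rewrite nabla_leibniz (linD (lwedge_linear_r w)) (linD (gcast_linear _)).
  rewrite scalerDr addrA.
  rewrite lwedge_act; congr (_ + _ *: _); rewrite lwedgeE. rewrite -pure_cast.
  rewrite -(bal_act (@pure_balanced _)).
  rewrite -(linZ (bal_linear (@pure_balanced _) e)).
  rewrite -(linD (bal_linear (@pure_balanced _) e)).
  by congr (pure _ e); apply: dif_act.
Qed.

Fact nabla_ext_linear n : linear (@nabla_ext n).
Proof. by apply: tens_lift_linear; apply: nabla_ext_balanced. Qed.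
HB.instance Definition _ n :=
  GRing.isLinear.Build k (tens n) (tens n.+1) *:%R (@nabla_ext n)
    (@nabla_ext_linear n).

Lemma nabla_extE n (w : Omega Om n) e :
  nabla_ext (pure w e) =
    pure (dif Om n w) e
    + (-1) ^+ n *: gcast (V := tens) (addn1 n) (lwedge w (D e)).
Proof. by rewrite /nabla_ext tens_liftE //; apply: nabla_ext_balanced. Qed.

Lemma nabla_ext0 (e : restr E) : nabla_ext (n := 0) e = D e.
Proof.
have := nabla_extE (n := 0) (1 : A) e; rewrite [pure _ _]scale1r => ->.
rewrite dif_one (lin0 (bal_linear (@pure_balanced 1) e)) add0r scale1r gcast_id.
exact: lwedge1.
Qed.

Lemma nabla_ext_lwedge m n (x : Omega Om m) (t : tens n) :
  nabla_ext (lwedge x t) = lwedge (dif Om m x) t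
    + (-1) ^+ m *: gcast (V := tens) (addnS m n) (lwedge x (nabla_ext t)).
Proof.
move: t; apply: tens_ext => [c t t'|c t t'|w e].
- by rewrite lwedge_linear_r linearP.
- rewrite !(lwedge_linear_r _ c) linearP (lwedge_linear_r _ c) linearP.
  rewrite !scalerDr !scalerA [c * _]mulrC -!addrA; congr (_ + _).
  by rewrite addrCA.
rewrite !lwedgeE !nabla_extE dif_wedge.
have L := bal_linear (@pure_balanced _) e.
rewrite (linD (L _)) (linZ (L _)) -addrA; congr (_ + _).
rewrite (linD (lwedge_linear_r x)) (linZ (lwedge_linear_r x)).
rewrite (linD (gcast_linear _)) (linZ (gcast_linear _)).
rewrite scalerDr scalerA -exprD lwedgeE pure_cast; congr (_ + _ *: _).
rewrite lwedge_cast gcast_trans -lwedgeA gcast_trans.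
exact: gcast_irr.
Qed.
Definition curvature (e : restr E) : tens 2 := nabla_ext (D e).
Definition flat := forall e, curvature e = 0.

Lemma nabla_ext_nabla_ext : flat -> forall n (t : tens n),
  nabla_ext (nabla_ext t) = 0.
Proof.
move=> fl n; apply: tens_ext => [c t t'|c t t'|w e].
- by rewrite !linearP.
- by rewrite scaler0 addr0.
rewrite nabla_extE (linD (@nabla_ext_linear _)) (linZ (@nabla_ext_linear _)).
rewrite nabla_extE dif_dif.
rewrite (lin0 (bal_linear (@pure_balanced _) e)) add0r.
rewrite (gcast_nat (V := tens) (W := tens) (s := S) nabla_ext).
rewrite nabla_ext_lwedge -[nabla_ext (D e)]/(curvature e) fl.
rewrite (lin0 (lwedge_linear_r w)) linear0 scaler0 addr0.
rewrite exprS mulN1r scaleNr addrC; apply/eqP; rewrite subr_eq0; apply/eqP.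
by congr (_ *: _); apply: gcast_irr.
Qed.
End Connection.

End FormsTensor.

Section Pushforward.
Variables (k : fieldType) (A : algType k) (Om : calculus A) (E F : lmodType A).
Variable phi : E -> F.

Definition id_tens n : tens Om E n -> tens Om F n :=
  tens_lift (fun w e => pure w (phi e)).

Hypothesis phi_linear : linear phi.

Lemma id_tens_balanced n :
  balanced (@form_act _ _ Om n) (fun w (e : E) => pure w (phi e)).
Proof.
have [L R B] := @pure_balanced _ _ Om F n.
split=> [e|w e e'|w a e]; first exact: L.
  by rewrite (linD phi_linear) R.
by rewrite B (linZ phi_linear).
Qed.

Lemma id_tens_linear n : linear (@id_tens n).
Proof. by apply: tens_lift_linear; apply: id_tens_balanced. Qed.

Lemma id_tensE n (w : Omega Om n) e : id_tens (pure w e) = pure w (phi e).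
Proof. by rewrite /id_tens tens_liftE //; apply: id_tens_balanced. Qed.

Lemma id_tens0 (e : restr E) : id_tens (n := 0) e = phi e.
Proof. exact: (scale1r (phi e)). Qed.
End Pushforward.

Lemma id_tens_id (k : fieldType) (A : algType k) (Om : calculus A)
    (E : lmodType A) n (t : tens Om E n) : id_tens id t = t.
Proof.
have idl : linear (id : E -> E) by [].
move: t; apply: tens_ext => [|//|w e]; first exact: id_tens_linear.
by rewrite id_tensE.
Qed.

Lemma id_tens_comp (k : fieldType) (A : algType k) (Om : calculus A)
    (E F G : lmodType A) (psi : F -> G) (phi : E -> F) :
  linear psi -> linear phi -> forall n (t : tens Om E n),
  id_tens (psi \o phi) t = id_tens psi (id_tens phi t).
Proof.
move=> Lpsi Lphi n.
have Lc : linear (psi \o phi) by move=> a u v /=; rewrite Lphi Lpsi.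
apply: tens_ext => [|c t t'|w e]; first exact: id_tens_linear.
  by rewrite !(id_tens_linear _ c).
by rewrite !id_tensE.
Qed.

Record category := Category {
  obj :> Type;
  mor : obj -> obj -> Type;
  idm : forall x, mor x x;
  compm : forall x y z, mor y z -> mor x y -> mor x z;
  compm1l : forall x y (f : mor x y), compm (idm y) f = f;
  compm1r : forall x y (f : mor x y), compm f (idm x) = f;
  compmA : forall x y z t (f : mor z t) (g : mor y z) (h : mor x y),
    compm f (compm g h) = compm (compm f g) h }.

Record is_functor (C D : category) (F0 : C -> D)
    (F1 : forall x y, mor x y -> mor (F0 x) (F0 y)) : Prop := IsFunctor {
  functor_id : forall x : C, F1 x x (idm x) = idm (F0 x);
  functor_comp : forall (x y z : C) (g : mor y z) (f : mor x y),
    F1 x z (compm g f) = compm (F1 y z g) (F1 x y f) }.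

Section FlatModules.
Variables (k : fieldType) (A : algType k) (Om : calculus A).

Record flat_module := FlatModule {
  fm_module :> lmodType A;
  fm_nabla : connection Om fm_module;
  fm_flat : flat fm_nabla }.

Record flat_hom (E F : flat_module) := FlatHom {
  fh_fun :> E -> F;
  fh_linear : linear fh_fun;
  fh_nabla : forall e : E, fm_nabla F (fh_fun e) = id_tens fh_fun (fm_nabla E e) }.

Lemma flat_hom_eq (E F : flat_module) (f g : flat_hom E F) : f =1 g -> f = g.
Proof.
case: f g => [f fl fn] [g gl gn] /= /funext fg; case: g / fg gl gn => gl gn.
by rewrite (Prop_irrelevance fl gl) (Prop_irrelevance fn gn).
Qed.

Fact flat_id_subproof (E : flat_module) (e : E) :
  fm_nabla E e = id_tens id (fm_nabla E e).
Proof. by rewrite id_tens_id. Qed.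
Definition flat_id (E : flat_module) : flat_hom E E :=
  @FlatHom E E id (fun _ _ _ => erefl) (@flat_id_subproof E).

Section Comp.
Variables (E F G : flat_module) (g : flat_hom F G) (f : flat_hom E F).
Fact flat_comp_linear : linear (g \o f).
Proof. by move=> a u v /=; rewrite !fh_linear. Qed.
Fact flat_comp_nabla (e : E) :
  fm_nabla G ((g \o f) e) = id_tens (g \o f) (fm_nabla E e).
Proof.
by rewrite (id_tens_comp (fh_linear g) (fh_linear f)) /= !fh_nabla.
Qed.
Definition flat_comp : flat_hom E G := FlatHom flat_comp_linear flat_comp_nabla.
End Comp.

Fact flat_comp1m (E F : flat_module) (f : flat_hom E F) :
  flat_comp (flat_id F) f = f.
Proof. exact: flat_hom_eq. Qed.
Fact flat_compm1 (E F : flat_module) (f : flat_hom E F) :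
  flat_comp f (flat_id E) = f.
Proof. exact: flat_hom_eq. Qed.
Fact flat_compA (E F G H : flat_module)
    (f : flat_hom G H) (g : flat_hom F G) (h : flat_hom E F) :
  flat_comp f (flat_comp g h) = flat_comp (flat_comp f g) h.
Proof. exact: flat_hom_eq. Qed.

Definition flat_category : category := Category flat_comp1m flat_compm1 flat_compA.

Definition flat_complex (E : flat_module) : complex k :=
  @Complex k (tens Om E) (nabla_ext (fm_nabla E)) (nabla_ext_nabla_ext (@fm_flat E)).

End FlatModules.

Section GradedModules.
Variables (k : fieldType) (V : nat -> lmodType k) (R : graded_algebra V).

Record graded_action (M : nat -> lmodType k) := GradedAction {
  gact : forall m n, V m -> M n -> M (m + n)%N;
  gact_linear_l : forall m n (y : M n), linear (fun x : V m => gact x y);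
  gact_linear_r : forall m n (x : V m), linear (fun y : M n => gact x y);
  gactA : forall m n p (x : V m) (y : V n) (z : M p),
    gcast (addnA m n p) (gact x (gact y z)) = gact (gmul R x y) z;
  gact1 : forall n (x : M n), gact (gone R) x = x }.

Record graded_module := GradedModule {
  gm_sort :> nat -> lmodType k;
  gm_action : graded_action gm_sort }.

Record graded_hom (M N : graded_module) := GradedHom {
  gh_fun : forall n, M n -> N n;
  gh_linear : forall n, linear (@gh_fun n);
  gh_act : forall m n (x : V m) (y : M n),
    gh_fun (gact (gm_action M) x y) = gact (gm_action N) x (gh_fun y) }.

Lemma graded_hom_eq (M N : graded_module) (f g : graded_hom M N) :
  (forall n (x : M n), gh_fun f x = gh_fun g x) -> f = g.
Proof.
case: f g => [f fl fa] [g gl ga] /= fg.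
have E : f = g by apply: functional_extensionality_dep => n; apply/funext/fg.
case: g / E gl ga {fg} => gl ga.
by rewrite (Prop_irrelevance fl gl) (Prop_irrelevance fa ga).
Qed.

Definition graded_id (M : graded_module) : graded_hom M M :=
  @GradedHom M M (fun _ => id) (fun _ _ _ _ => erefl) (fun _ _ _ _ => erefl).

Section Comp.
Variables (M N P : graded_module) (g : graded_hom N P) (f : graded_hom M N).
Definition graded_comp_fun n (x : M n) : P n := gh_fun g (gh_fun f x).
Fact graded_comp_linear n : linear (@graded_comp_fun n).
Proof. by move=> a u v; rewrite /graded_comp_fun !gh_linear. Qed.
Fact graded_comp_act m n (x : V m) (y : M n) :
  graded_comp_fun (gact (gm_action M) x y) =
  gact (gm_action P) x (graded_comp_fun y).
Proof. by rewrite /graded_comp_fun !gh_act. Qed.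
Definition graded_comp : graded_hom M P :=
  GradedHom graded_comp_linear graded_comp_act.
End Comp.

Fact graded_comp1m (M N : graded_module) (f : graded_hom M N) :
  graded_comp (graded_id N) f = f.
Proof. exact: graded_hom_eq. Qed.
Fact graded_compm1 (M N : graded_module) (f : graded_hom M N) :
  graded_comp f (graded_id M) = f.
Proof. exact: graded_hom_eq. Qed.
Fact graded_compA (M N P Q : graded_module)
    (f : graded_hom P Q) (g : graded_hom N P) (h : graded_hom M N) :
  graded_comp f (graded_comp g h) = graded_comp (graded_comp f g) h.
Proof. exact: graded_hom_eq. Qed.

Definition graded_category : category :=
  Category graded_comp1m graded_compm1 graded_compA.
End GradedModules.

(* Main.v *)
Require Import Defs.
From mathcomp Require Import all_boot all_order all_algebra.

Set Implicit Arguments.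
Unset Strict Implicit.
Unset Printing Implicit Defensive.

(** The theorem rests on identities between cochains; the passage to
    cohomology is then a choice of representatives.

    The Leibniz rule [nabla_ext_lwedge] says that the extended connection is a
    derivation over d with respect to the wedge product, so the product of a
    closed form and a cocycle is a cocycle, and it is a coboundary as soon as
    one of the two factors is one.  Hence the wedge product descends to a pairing of
    cohomology groups ([twisted_actP]).  A class is determined by any of its
    representatives, and the module axioms hold for the wedge product of
    representatives ([lwedgeA], [lwedge1]), so they hold for classes.

    A morphism phi of flat modules intertwines the connections.  On a pure tensor
    w (x) e the extended connection is built from d w and from w /\ nabla e, and
    id (x) phi commutes with left wedge products ([id_tens_lwedge]); therefore
    id (x) phi is a cochain map ([id_tens_nabla_ext]) and induces a map of
    cohomology groups.  The same commutation with wedge products makes this map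
    a module morphism.  Functoriality is that of the tensor product
    ([id_tens_id], [id_tens_comp]), read on representatives. *)

Import GRing.Theory.
Local Open Scope ring_scope.

(** * The map on cohomology induced by a cochain map *)

Section CochainMap.
Variables (k : fieldType) (C D : complex k) (f : forall n, C n -> D n).
Hypothesis f_linear : forall n, linear (@f n).
Hypothesis f_cdiff : forall n (x : C n), cdiff D n (f x) = f (cdiff C n x).

Definition cohomology_map n (h : cohomology C n) : cohomology D n :=
  coh_class (f (kernel_val (repr h))).

Lemma cochain_map_cocycle n (x : C n) :
  cdiff C n x = 0 -> cdiff D n (f x) = 0.
Proof. by move=> dx; rewrite f_cdiff dx (lin0 (@f_linear _)). Qed.

Lemma cochain_map_coboundary n (x : C n) : coboundary x -> coboundary (f x).
Proof.
case: n x => [|n] x /=; first by move=> ->; apply: (lin0 (@f_linear _)).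
by case=> y <-; exists (f y); rewrite f_cdiff.
Qed.

(** The representative chosen in the definition is immaterial: two of them differ
    by a coboundary, and so do their images. *)
Lemma cohomology_mapP n (x : C n) h :
  represents x h -> represents (f x) (cohomology_map h).
Proof.
move=> Hx; have Hh := represents_repr h.
have Fx := coh_class_represents (cochain_map_cocycle (represents_cdiff Hx)).
have Fh := coh_class_represents (cochain_map_cocycle (represents_cdiff Hh)).
suff E : coh_class (f x) = cohomology_map h by rewrite -E.
apply/(represents_eqP Fx Fh); rewrite -(linB (@f_linear n)).
by apply: cochain_map_coboundary; apply/(represents_eqP Hx Hh).
Qed.

Lemma cohomology_map_linear n : linear (@cohomology_map n).
Proof.
move=> a h g.
have [x Hx] := represents_ex h; have [y Gy] := represents_ex g.
have L := cohomology_mapP (represents_linear a Hx Gy).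
have R := represents_linear a (cohomology_mapP Hx) (cohomology_mapP Gy).
by rewrite f_linear in L; apply: represents_inj L R.
Qed.
End CochainMap.

(** * The action of de Rham cohomology on the cohomology of a flat module *)

Section Action.
Variables (k : fieldType) (A : algType k) (Om : calculus A).
Variable E : flat_module Om.
Local Notation H := (cohomology (deRham Om)).
Local Notation M := (cohomology (flat_complex E)).

Definition twisted_act m n (h : H m) (g : M n) : M (m + n) :=
  cohomology_pairing (C := deRham Om) (D := flat_complex E)
    (F := flat_complex E) (fun m n x t => @lwedge _ _ Om E m n x t) h g.

Lemma twisted_actP m n (x : deRham Om m) (t : flat_complex E n) h g :
  represents x h -> represents t g ->
  represents (C := flat_complex E) (n := (m + n)%N)
    (lwedge x t) (twisted_act h g).
Proof.
apply: cohomology_pairingP.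
- by move=> m' n' y; apply: lwedge_linear_l.
- by move=> m' n' y; apply: lwedge_linear_r.
- by move=> m' n' y u; apply: nabla_ext_lwedge.
Qed.

Fact twisted_act_linear_l m n (g : M n) :
  linear (fun h : H m => twisted_act h g).
Proof.
move=> a h h'.
have [x Hx] := represents_ex h; have [x' Hx'] := represents_ex h'.
have [t Gt] := represents_ex g.
have L := twisted_actP (represents_linear a Hx Hx') Gt.
have R := represents_linear a (twisted_actP Hx Gt) (twisted_actP Hx' Gt).
by rewrite (lwedge_linear_l t) in L; apply: represents_inj L R.
Qed.

Fact twisted_act_linear_r m n (h : H m) :
  linear (fun g : M n => twisted_act h g).
Proof.
move=> a g g'.
have [t Gt] := represents_ex g; have [t' Gt'] := represents_ex g'.
have [x Hx] := represents_ex h.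
have L := twisted_actP Hx (represents_linear a Gt Gt').
have R := represents_linear a (twisted_actP Hx Gt) (twisted_actP Hx Gt').
by rewrite (lwedge_linear_r x) in L; apply: represents_inj L R.
Qed.

Fact twisted_actA m n p (h : H m) (h' : H n) (g : M p) :
  gcast (V := M) (addnA m n p) (twisted_act h (twisted_act h' g)) =
  twisted_act (gmul (deRham_algebra Om) h h') g.
Proof.
have [x Hx] := represents_ex h; have [y Hy] := represents_ex h'.
have [t Gt] := represents_ex g.
have L := represents_cast (addnA m n p) (twisted_actP Hx (twisted_actP Hy Gt)).
have R := twisted_actP (deRham_mulP Hx Hy) Gt.
by rewrite lwedgeA in L; apply: represents_inj L R.
Qed.

Fact twisted_act1 n (g : M n) : twisted_act (gone (deRham_algebra Om)) g = g.
Proof.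
have [t Gt] := represents_ex g; have := twisted_actP (deRham_oneP Om) Gt.
by rewrite lwedge1 => L; apply: represents_inj L Gt.
Qed.

Definition twisted_action : graded_action (deRham_algebra Om) M := GradedAction
  twisted_act_linear_l twisted_act_linear_r twisted_actA twisted_act1.
End Action.

(** * Morphisms of flat modules *)

Section Morphism.
Variables (k : fieldType) (A : algType k) (Om : calculus A).

(** Both sides send w (x) e to (x /\ w) (x) phi e: the wedge product acts on the
    left factor and phi on the right one. *)
Lemma id_tens_lwedge (E F : lmodType A) (phi : E -> F) : linear phi ->
  forall m n (x : Omega Om m) (t : tens Om E n),
  id_tens phi (lwedge x t) = lwedge x (id_tens phi t).
Proof.
move=> Lphi m n x; apply: tens_ext => [a t t'|a t t'|w e].
- by rewrite lwedge_linear_r (id_tens_linear Lphi).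
- by rewrite (id_tens_linear Lphi) lwedge_linear_r.
- by rewrite lwedgeE !id_tensE // lwedgeE.
Qed.

Lemma id_tens_cast (E F : lmodType A) (phi : E -> F) m n (e : m = n)
    (t : tens Om E m) :
  id_tens phi (gcast (V := tens Om E) e t)
  = gcast (V := tens Om F) e (id_tens phi t).
Proof. by case: n / e; rewrite !gcast_id. Qed.

Section FlatHom.
Variables (E F : flat_module Om) (phi : flat_hom E F).
Let Lphi := fh_linear phi.

(** On pure tensors the d w terms agree at once, and the nabla e terms agree
    because phi intertwines the connections. *)
Lemma id_tens_nabla_ext n (t : tens Om E n) :
  nabla_ext (fm_nabla F) (id_tens phi t) = id_tens phi (nabla_ext (fm_nabla E) t).
Proof.
move: t; apply: tens_ext => [a t t'|a t t'|w e].
- by rewrite (id_tens_linear Lphi) nabla_ext_linear.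
- by rewrite nabla_ext_linear (id_tens_linear Lphi).
rewrite id_tensE // !nabla_extE.
rewrite (linD (id_tens_linear Lphi (n := _))) (linZ (id_tens_linear Lphi (n := _))).
by rewrite id_tensE // id_tens_cast id_tens_lwedge // fh_nabla.
Qed.

Definition twisted_map n :
    cohomology (flat_complex E) n -> cohomology (flat_complex F) n :=
  cohomology_map (C := flat_complex E) (D := flat_complex F)
    (fun n t => id_tens (n := n) phi t) (n := n).

Lemma twisted_mapP n (t : flat_complex E n) g :
  represents t g ->
  represents (C := flat_complex F) (n := n) (id_tens phi t) (twisted_map g).
Proof.
apply: cohomology_mapP => m; first exact: id_tens_linear.
exact: id_tens_nabla_ext.
Qed.

Fact twisted_map_linear n : linear (@twisted_map n).
Proof.
apply: cohomology_map_linear => m; first exact: id_tens_linear.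
exact: id_tens_nabla_ext.
Qed.

Fact twisted_map_act m n (h : cohomology (deRham Om) m)
    (g : cohomology (flat_complex E) n) :
  twisted_map (twisted_act h g) = twisted_act h (twisted_map g).
Proof.
have [x Hx] := represents_ex h; have [t Gt] := represents_ex g.
have L := twisted_mapP (twisted_actP Hx Gt).
have R := twisted_actP Hx (twisted_mapP Gt).
by rewrite id_tens_lwedge // in L; apply: represents_inj L R.
Qed.

Definition twisted_hom : graded_hom
    (GradedModule (twisted_action E)) (GradedModule (twisted_action F)) :=
  @GradedHom _ _ (deRham_algebra Om)
    (GradedModule (twisted_action E)) (GradedModule (twisted_action F))
    twisted_map twisted_map_linear twisted_map_act.
End FlatHom.

Lemma twisted_map_id (E : flat_module Om) n (g : cohomology (flat_complex E) n) :
  twisted_map (flat_id E) g = g.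
Proof.
have [t Gt] := represents_ex g; have := twisted_mapP (flat_id E) Gt.
by rewrite id_tens_id => L; apply: represents_inj L Gt.
Qed.

Lemma twisted_map_comp (E F G : flat_module Om) (psi : flat_hom F G)
    (phi : flat_hom E F) n (g : cohomology (flat_complex E) n) :
  twisted_map (flat_comp psi phi) g = twisted_map psi (twisted_map phi g).
Proof.
have [t Gt] := represents_ex g.
have L := twisted_mapP (flat_comp psi phi) Gt.
have R := twisted_mapP psi (twisted_mapP phi Gt).
rewrite (id_tens_comp (fh_linear psi) (fh_linear phi)) in L.
exact: represents_inj L R.
Qed.
End Morphism.

Local Close Scope ring_scope.

Theorem theorem2p6 (k : fieldType) (A : algType k) (Om : calculus A) :
  exists (act : forall E : flat_category Om,
            graded_action (deRham_algebra Om) (cohomology (flat_complex E)))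
         (ind : forall E F : flat_category Om, mor E F ->
            @mor (graded_category (deRham_algebra Om))
              (GradedModule (act E)) (GradedModule (act F))),
  [/\ is_functor ind,
      forall (E : flat_category Om) (m n : nat)
        (xi : deRham Om m) (x : flat_complex E n)
        (h : cohomology (deRham Om) m) (g : cohomology (flat_complex E) n),
        represents xi h -> represents x g ->
        @represents _ (flat_complex E) (m + n)%N
          (lwedge xi x) (gact (act E) h g)
    & forall (E F : flat_category Om) (phi : mor E F) (n : nat)
        (x : flat_complex E n) (g : cohomology (flat_complex E) n),
        represents x g ->
        @represents _ (flat_complex F) n
          (id_tens (fh_fun phi) x) (gh_fun (ind E F phi) g)].
Proof.
exists (@twisted_action _ _ Om), (@twisted_hom _ _ Om); split.
- split=> [E|E F G psi phi]; apply: graded_hom_eq => n g.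
    exact: twisted_map_id.
  exact: twisted_map_comp.
- by move=> E m n xi x h g; apply: twisted_actP.
- by move=> E F phi n x g; apply: twisted_mapP.
Qed.
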